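(* Let $Y$ be a finite-dimensional subspace of the real Banach space $\ell_1$. Then $Y$ has property-$(SU)$ in $\ell_1$ if and only if $Y$ has property-$(U)$ in $\ell_1$ and $Y$ is isometrically isomorphic to $\ell_1(\dim(Y))$.
   Context: $\ell_1(n)$ is $\mathbb{R}^n$ with the $\ell_1$-norm. For a closed subspace $Y$ of a Banach space $X$, $Y^\perp=\{x^*\in X^*: x^*(y)=0\ \forall y\in Y\}$. $Y$ has property-$(U)$ in $X$ if every bounded linear functional on $Y$ has a unique norm-preserving extension to $X$. $Y$ has property-$(SU)$ in $X$ if there is a closed subspace $G$ of $X^*$ with $X^*=G\oplus Y^\perp$ such that for each $x^*\in X^*$, $\|x^*\|>\|y^\#\|$ whenever $x^*=y^\#+y^\perp$ with $y^\#\in G$ and $0\neq y^\perp\in Y^\perp$. *)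

(* Defs.v *)
From HB Require Import structures.
From mathcomp Require Import all_boot all_order all_algebra.
From mathcomp Require Import boolp classical_sets functions cardinality reals.
From mathcomp Require Import topology normedtype sequences.

Set Implicit Arguments.
Unset Strict Implicit.
Unset Printing Implicit Defensive.

Import Order.TTheory GRing.Theory Num.Theory.
Import numFieldTopology.Exports numFieldNormedType.Exports.

Local Open Scope classical_set_scope.
Local Open Scope ring_scope.

Section ell1.
Variable R : realType.
Implicit Types u v : nat -> R.

Definition absolutely_summable : {pred (nat -> R)} :=
  [pred u : nat -> R | `[< cvgn (series (fun k => `|u k|)) >]].

Lemma absolutely_summableP u :
  reflect (cvgn (series (fun k => `|u k|))) (u \in absolutely_summable).
Proof. exact: asboolP. Qed.

Definition sum_norm u : R := limn (series (fun k => `|u k|)).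

Lemma sum_norm_ub u M : (forall n, \sum_(0 <= k < n) `|u k| <= M) ->
  u \in absolutely_summable /\ sum_norm u <= M.
Proof.
move=> uM.
have cu : cvgn (series (fun k => `|u k|)).
  apply: nondecreasing_is_cvgn.
    apply/nondecreasing_seqP => n.
    by rewrite /series/= big_nat_recr//= lerDl.
  by exists M => _ [n _ <-]; exact: uM.
split; first exact/absolutely_summableP.
by apply: limr_le => //; near=> n; exact: uM.
Unshelve. all: by end_near. Qed.

Lemma sum_norm_partial u : u \in absolutely_summable ->
  forall n, \sum_(0 <= k < n) `|u k| <= sum_norm u.
Proof.
move=> /absolutely_summableP cu n.
apply: (@nondecreasing_cvgn_le R (series (fun k => `|u k|))) => //.
apply/nondecreasing_seqP => m.
by rewrite /series/= big_nat_recr//= lerDl.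
Qed.

Lemma sum_normD_le u v : u \in absolutely_summable ->
  v \in absolutely_summable ->
  (u + v) \in absolutely_summable /\
  sum_norm (u + v) <= sum_norm u + sum_norm v.
Proof.
move=> su sv; apply: sum_norm_ub => n.
apply: (@le_trans _ _ (\sum_(0 <= k < n) (`|u k| + `|v k|))).
  by apply: ler_sum => k _; exact: ler_normD.
by rewrite big_split/= lerD// sum_norm_partial.
Qed.

Lemma sum_normZ_le (a : R) u : u \in absolutely_summable ->
  (a *: u) \in absolutely_summable /\ sum_norm (a *: u) <= `|a| * sum_norm u.
Proof.
move=> su; apply: sum_norm_ub => n.
rewrite (eq_bigr (fun k => `|a| * `|u k|)) => [|k _]; last first.
  by rewrite -normrM.
by rewrite -big_distrr/= ler_wpM2l// sum_norm_partial.
Qed.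

Lemma absolutely_summable_submod : submod_closed absolutely_summable.
Proof.
split.
  have [] // := @sum_norm_ub 0 0.
  by move=> n; rewrite big1// => k _; rewrite normr0.
move=> a u v su sv.
by have [+ _] := sum_normD_le (proj1 (sum_normZ_le a su)) sv.
Qed.
HB.instance Definition _ := GRing.isSubmodClosed.Build R (nat -> R)
  absolutely_summable absolutely_summable_submod.

Record ell1 := Ell1 {
  ell1_seq :> nat -> R ;
  _ : ell1_seq \in absolutely_summable }.

HB.instance Definition _ := [isSub for ell1_seq].
HB.instance Definition _ := [Choice of ell1 by <:].
HB.instance Definition _ := [SubChoice_isSubLmodule of ell1 by <:].

Definition ell1_norm (u : ell1) : R := sum_norm u.

Lemma ell1_normD (u v : ell1) : ell1_norm (u + v) <= ell1_norm u + ell1_norm v.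
Proof. by have [] := sum_normD_le (valP u) (valP v). Qed.

Lemma ell1_normZ (a : R) (u : ell1) : ell1_norm (a *: u) = `|a| * ell1_norm u.
Proof.
have le b (v : ell1) : ell1_norm (b *: v) <= `|b| * ell1_norm v.
  by have [] := sum_normZ_le b (valP v).
apply/eqP; rewrite eq_le le/=.
have [->|a0] := eqVneq a 0.
  rewrite normr0 mul0r; have := sum_norm_partial (valP (0 *: u : ell1)) 0%N.
  by rewrite big_geq.
have := le a^-1 (a *: u).
by rewrite scalerA mulVf// scale1r normfV ler_pdivlMl ?normr_gt0.
Qed.

Lemma ell1_norm_eq0 (u : ell1) : ell1_norm u = 0 -> u = 0.
Proof.
move=> u0; apply/val_inj/funext => k /=; apply/normr0_eq0/eqP.
rewrite eq_le normr_ge0 andbT -u0.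
apply: le_trans (sum_norm_partial (valP u) k.+1).
by rewrite big_nat_recr//= lerDr sumr_ge0.
Qed.

HB.instance Definition _ := Lmodule_isNormed.Build R ell1
  ell1_normD ell1_normZ ell1_norm_eq0.

Lemma ell1_seqD (u v : ell1) k : (u + v) k = u k + v k.
Proof. by []. Qed.

Lemma ell1_seqB (u v : ell1) k : (u - v) k = u k - v k.
Proof. by []. Qed.

Lemma ell1_seqZ (a : R) (u : ell1) k : (a *: u) k = a * u k.
Proof. by []. Qed.

Lemma ell1_normE (u : ell1) : `|u| = limn (series (fun k => `|u k|)).
Proof. by []. Qed.

Lemma ell1_norm_partial (u : ell1) n : \sum_(0 <= k < n) `|u k| <= `|u|.
Proof. exact: sum_norm_partial (valP u) n. Qed.

Lemma ell1_norm_coord (u : ell1) k : `|u k| <= `|u|.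
Proof.
apply: le_trans (ell1_norm_partial u k.+1).
by rewrite big_nat_recr//= lerDr sumr_ge0.
Qed.

Lemma ell1_complete (F : set_system ell1) :
  ProperFilter F -> cauchy F -> cvg F.
Proof.
move=> FF /cauchyP Fc.
have cvgk k : cvg ((fun v : ell1 => v k) @ F).
  apply: R_complete; apply/cauchyP => e e0.
  have [u Fu] := Fc e e0; exists (u k).
  suff: F [set v : ell1 | ball (u k) e (v k)] by [].
  apply: filterS Fu => v; rewrite -!ball_normE/=; apply: le_lt_trans.
  exact: (ell1_norm_coord (u - v) k).
pose l k : R := lim ((fun v : ell1 => v k) @ F).
have near_l e (u : ell1) : F (ball u e) ->
    forall n, \sum_(0 <= k < n) `|u k - l k| <= e.
  move=> Fu n.
  have cvgn_ : (fun v : ell1 => \sum_(0 <= k < n) `|u k - v k|) @ F -->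
              \sum_(0 <= k < n) `|u k - l k|.
    elim: n => [|n IHn].
      by under eq_fun do rewrite big_geq//; rewrite big_geq//; exact: cvg_cst.
    under eq_fun do rewrite big_nat_recr//=.
    rewrite big_nat_recr//=; apply: cvgD => //.
    apply: cvg_norm; apply: cvgB; [exact: cvg_cst|exact: cvgk].
  rewrite -(cvg_lim _ cvgn_)//; apply: limr_le.
    by apply/cvg_ex; eexists; exact: cvgn_.
  apply: filterS Fu => v; rewrite -ball_normE/= => /ltW.
  apply: le_trans.
  exact: ell1_norm_partial (u - v) n.
have sl : l \in absolutely_summable.
  have [u Fu] := Fc 1 ltr01.
  have [sul _] := sum_norm_ub (near_l _ _ Fu).
  rewrite (_ : l = \val u - (fun k => u k - l k)); last first.
    by apply/funext => k; rewrite !fctE opprB addrC subrK.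
  by rewrite rpredB ?(valP u).
pose L : ell1 := Ell1 sl.
apply/cvg_ex; exists L; apply/cvgrPdist_le => e e0.
have [u Fu] := Fc (e / 2) (divr_gt0 e0 (ltr0Sn _ 1)).
have uL : `|u - L| <= e / 2.
  exact: (proj2 (sum_norm_ub (near_l _ _ Fu))).
apply: filterS Fu => v; rewrite -ball_normE/= => /ltW uv.
apply: le_trans (ler_distD u L v) _.
by rewrite (splitr e) lerD// distrC.
Qed.

HB.instance Definition _ := Uniform_isComplete.Build ell1 ell1_complete.

End ell1.

(* An alias, because the canonical norm on 'rV[R]_n is the sup norm; only the
   module structure is inherited from it. *)
Definition ell1n (R : realType) (n : nat) : Type := 'rV[R]_n.

Section ell1n.
Variables (R : realType) (n : nat).

HB.instance Definition _ := GRing.Lmodule.copy (ell1n R n) 'rV[R]_n.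

Definition ell1n_norm (x : ell1n R n) : R :=
  \sum_(i < n) `|(x : 'rV[R]_n) ord0 i|.

Lemma ell1n_normD x y : ell1n_norm (x + y) <= ell1n_norm x + ell1n_norm y.
Proof.
by rewrite -big_split ler_sum// => i _; rewrite mxE ler_normD.
Qed.

Lemma ell1n_normZ (a : R) x : ell1n_norm (a *: x) = `|a| * ell1n_norm x.
Proof.
by rewrite /ell1n_norm big_distrr; apply: eq_bigr => i _; rewrite mxE normrM.
Qed.

Lemma ell1n_norm_eq0 x : ell1n_norm x = 0 -> x = 0.
Proof.
move=> /eqP; rewrite psumr_eq0 => [/allP x0|//].
apply/rowP => i; rewrite mxE; apply/normr0_eq0/eqP.
by apply: x0; rewrite mem_index_enum.
Qed.

HB.instance Definition _ := Lmodule_isNormed.Build R (ell1n R n)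
  ell1n_normD ell1n_normZ ell1n_norm_eq0.

End ell1n.

Section dual_space.
Variables (R : realType) (X : normedModType R).

Definition bounded_functional : {pred (X -> R)} :=
  [pred f : X -> R |
    `[< scalar f /\ exists M : R, forall x, `|f x| <= M * `|x| >]].

Lemma bounded_functionalP (f : X -> R) :
  reflect (scalar f /\ exists M : R, forall x, `|f x| <= M * `|x|)
          (f \in bounded_functional).
Proof. exact: asboolP. Qed.

Lemma bounded_functional_submod : submod_closed bounded_functional.
Proof.
split.
  apply/bounded_functionalP; split.
    by move=> a x y; rewrite /= mulr0 addr0.
  by exists 0 => x; rewrite normr0 mul0r.
move=> a f g /bounded_functionalP[lf [M fM]] /bounded_functionalP[lg [N gN]].
apply/bounded_functionalP; split.
  move=> b x y; pose E z : (a *: f + g) z = a * f z + g z := erefl.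
  by rewrite !E lf lg !mulrDr addrACA mulrCA.
exists (`|a| * M + N) => x; apply: (le_trans (ler_normD _ _)).
by rewrite mulrDl lerD// normrM -mulrA ler_wpM2l.
Qed.
HB.instance Definition _ := GRing.isSubmodClosed.Build R (X -> R)
  bounded_functional bounded_functional_submod.

Record dual_space := DualSpace {
  dual_fun :> X -> R ;
  _ : dual_fun \in bounded_functional }.

HB.instance Definition _ := [isSub for dual_fun].
HB.instance Definition _ := [Choice of dual_space by <:].
HB.instance Definition _ := [SubChoice_isSubLmodule of dual_space by <:].

Definition dual_norm (f : dual_space) : R :=
  sup [set `|f x| | x in [set x : X | `|x| <= 1]].

Lemma dual_norm_has_sup (f : dual_space) :
  has_sup [set `|f x| | x in [set x : X | `|x| <= 1]].
Proof.
split; first by exists `|f 0|, 0 => //=; rewrite normr0.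
have /bounded_functionalP[_ [M fM]] := valP f.
exists `|M| => _ [x x1 <-]; apply: le_trans (fM x) _.
apply: le_trans (ler_norm _) _; rewrite normrM normr_id.
by rewrite ler_piMr.
Qed.

Lemma dual_norm_ub (f : dual_space) x : `|f x| <= dual_norm f * `|x|.
Proof.
have /bounded_functionalP[lf _] :
  dual_fun f \in bounded_functional := valP f.
have fZ a y : f (a *: y) = a * f y.
  have f0 : f 0 = 0.
    by have := lf (-1) 0 0; rewrite scaleN1r mulN1r !addNr.
  by have := lf a y 0; rewrite !addr0 f0 addr0.
have [->|x0] := eqVneq x 0.
  have f0 : f 0 = 0 by have := fZ 0 0; rewrite scale0r mul0r.
  by rewrite f0 !normr0 mulr0.
rewrite -ler_pdivrMr ?normr_gt0//.
apply: (sup_upper_bound (dual_norm_has_sup f)).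
exists (`|x|^-1 *: x) => /=.
  by rewrite normrZ normfV normr_id mulVf// normr_eq0.
by rewrite fZ normrM normfV normr_id mulrC.
Qed.

Lemma dual_norm_le (f : dual_space) (M : R) :
  (forall x, `|x| <= 1 -> `|f x| <= M) -> dual_norm f <= M.
Proof.
move=> fM; apply: ge_sup; first by have [] := dual_norm_has_sup f.
by move=> _ [x x1 <-]; exact: fM.
Qed.

Lemma dual_norm_ball (f : dual_space) x : `|x| <= 1 -> `|f x| <= dual_norm f.
Proof.
by move=> x1; apply: (sup_upper_bound (dual_norm_has_sup f)); exists x.
Qed.

Lemma dual_normD (f g : dual_space) :
  dual_norm (f + g) <= dual_norm f + dual_norm g.
Proof.
apply: dual_norm_le => x x1; apply: le_trans (ler_normD _ _) _.
by rewrite lerD// dual_norm_ball.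
Qed.

Lemma dual_normZ (a : R) (f : dual_space) :
  dual_norm (a *: f) = `|a| * dual_norm f.
Proof.
have le b (g : dual_space) : dual_norm (b *: g) <= `|b| * dual_norm g.
  apply: dual_norm_le => x x1.
  by rewrite [_ x]/(b * g x) normrM ler_wpM2l// dual_norm_ball.
apply/eqP; rewrite eq_le le/=.
have [->|a0] := eqVneq a 0.
  rewrite normr0 mul0r; have := @dual_norm_ball (0 *: f) 0.
  by rewrite normr0 => /(_ ler01); exact: le_trans.
have := le a^-1 (a *: f).
by rewrite scalerA mulVf// scale1r normfV ler_pdivlMl ?normr_gt0.
Qed.

Lemma dual_norm_eq0 (f : dual_space) : dual_norm f = 0 -> f = 0.
Proof.
move=> f0; apply/val_inj/funext => x; apply/normr0_eq0/eqP.
by rewrite eq_le normr_ge0 andbT -(mul0r `|x|) -f0 dual_norm_ub.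
Qed.

HB.instance Definition _ := Lmodule_isNormed.Build R dual_space
  dual_normD dual_normZ dual_norm_eq0.

End dual_space.

Section lin_subspace.
Variables (R : realType) (X : normedModType R) (Y : submodClosed X).

Record lin_subspace := LinSubspace {
  lin_subspace_val : X ;
  _ : lin_subspace_val \in Y }.

HB.instance Definition _ := [isSub for lin_subspace_val].
HB.instance Definition _ := [Choice of lin_subspace by <:].
HB.instance Definition _ := [SubChoice_isSubLmodule of lin_subspace by <:].

Definition lin_subspace_norm (y : lin_subspace) : R := `|\val y|.

Lemma lin_subspace_normD y z :
  lin_subspace_norm (y + z) <= lin_subspace_norm y + lin_subspace_norm z.
Proof. exact: ler_normD. Qed.

Lemma lin_subspace_normZ (a : R) y :
  lin_subspace_norm (a *: y) = `|a| * lin_subspace_norm y.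
Proof. exact: normrZ. Qed.

Lemma lin_subspace_norm_eq0 y : lin_subspace_norm y = 0 -> y = 0.
Proof. by move=> /normr0_eq0 y0; apply: val_inj. Qed.

HB.instance Definition _ := Lmodule_isNormed.Build R lin_subspace
  lin_subspace_normD lin_subspace_normZ lin_subspace_norm_eq0.

End lin_subspace.

Section dimension.
Variables (R : realType) (V : lmodType R).

Definition is_basis (n : nat) (b : 'I_n -> V) :=
  forall v, exists! a : 'rV[R]_n, v = \sum_(i < n) a ord0 i *: b i.

Definition has_dimension (n : nat) := exists b : 'I_n -> V, is_basis b.

Definition finite_dimensional := exists n, has_dimension n.

(* 0 is a junk value for the infinite-dimensional case; see dimensionE. *)
Definition dimension : nat := xget 0%N [set n | has_dimension n].

Lemma has_dimension_inj (m n : nat) :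
  has_dimension m -> has_dimension n -> m = n.
Proof.
have le p q : has_dimension p -> has_dimension q -> (p <= q)%N.
  move=> [b hb] [c hc].
  have /choice[B bE] : forall i, exists a : 'rV[R]_q,
      b i = \sum_(j < q) a ord0 j *: c j.
    by move=> i; have [a [? _]] := hc (b i); exists a.
  have /choice[C cE] : forall j, exists a : 'rV[R]_p,
      c j = \sum_(i < p) a ord0 i *: b i.
    by move=> j; have [a [? _]] := hb (c j); exists a.
  pose A := \matrix_(i < p, j < q) B i ord0 j.
  pose D := \matrix_(j < q, i < p) C j ord0 i.
  apply: (@mulmx1_min _ _ _ A D); apply/row_matrixP => i.
  have [a [_ aP]] := hb (b i).
  have <- : a = row i 1%:M.
    apply: aP; rewrite (bigD1 i)//= !mxE eqxx scale1r big1 ?addr0// => k ki.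
    by rewrite !mxE eq_sym (negbTE ki) scale0r.
  apply/esym/aP; rewrite {1}(bE i).
  under eq_bigr => j _ do rewrite {1}(cE j) scaler_sumr.
  rewrite exchange_big/=; apply: eq_bigr => k _.
  rewrite !mxE scaler_suml; apply: eq_bigr => j _.
  by rewrite scalerA !mxE.
by move=> hm hn; apply/eqP; rewrite eqn_leq !le.
Qed.

Lemma dimensionE (n : nat) : has_dimension n -> dimension = n.
Proof. by move=> hn; apply: xget_unique => // m /has_dimension_inj; exact. Qed.

End dimension.

Definition isometrically_isomorphic (R : realType) (V W : normedModType R) :=
  exists T : {linear V -> W}, bijective T /\ forall v, `|T v| = `|v|.

(* Closedness of Y is not built into the next definitions: it is meant to be
   assumed (or, for a finite-dimensional Y, is automatic). *)
Section properties.
Variables (R : realType) (X : normedModType R) (Y : submodClosed X).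

Definition annihilator : set (dual_space X) :=
  [set f | forall y, y \in Y -> f y = 0].

Definition property_U := forall f : dual_space (lin_subspace Y),
  exists! g : dual_space X,
    (forall y : lin_subspace Y, g (\val y) = f y) /\ `|g| = `|f|.

Definition property_SU := exists G : submodClosed (dual_space X),
  [/\ closed [set` G],
      (forall f : dual_space X, exists! p : dual_space X * dual_space X,
         [/\ p.1 \in G, annihilator p.2 & f = p.1 + p.2]) &
      (forall f g h : dual_space X, g \in G -> annihilator h -> h != 0 ->
         f = g + h -> `|g| < `|f|)].

End properties.

(* Main.v *)
From HB Require Import structures.
Require Import Defs.
From mathcomp Require Import all_boot all_order all_algebra.
From mathcomp Require Import boolp classical_sets functions reals.
From mathcomp Require Import topology normedtype sequences.
From mathcomp Require Import lra.

(** Both sides of the equivalence turn on linear projections P of norm at most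
one from [ell1] onto [Y].

If such a P exists, properties (SU) and (U) are equivalent, in any normed
space: composing with P extends every functional on [Y] linearly without
increasing its norm, so that G = {g | g o P = g} is a complement of the
annihilator of [Y], and uniqueness of norm-preserving extensions is then the
same thing as the strict inequality of (SU)
([contractive_projection_SU_U], [contractive_projection_U_SU]).

A finite-dimensional [Y] has a basis y_i that is dual to n coordinates k_i of
the sequence space: y_i(k_j) is 1 if i = j and 0 otherwise.  Under (SU),
decompose each coordinate functional ev_(k_i) as g_i plus an annihilating
functional, with g_i in G; then P x = sum_i g_i(x) y_i is a projection onto
[Y].  Its norm is at most one, because a norm-one functional that norms P x
can be replaced by its component in G, and that component is unchanged by P
([property_SU_contractive_projection]).

If P exists, the y_i have pairwise disjoint supports, so that normalizing them
identifies [Y] isometrically with [ell1n] ([contractive_projection_isometry]).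
Indeed, let delta_q be the unit vector at a coordinate q in the support of
y_i.  Splitting y_i into its part at q and the rest loses nothing in the
triangle inequality, neither before nor after applying P; hence P delta_q is a
nonzero vector supported in the support of y_i, and biorthogonality makes it a
multiple of y_i.  The coordinate q then determines i.

Conversely, an isometry with [ell1n] gives [Y] a basis e_i of unit vectors with
the ell1 norm identity.  That identity forces the e_i to have disjoint
supports, and P x = sum_i <sgn e_i, x> e_i is a projection of norm at most one
([isometry_contractive_projection]). *)

Set Implicit Arguments.
Unset Strict Implicit.
Unset Printing Implicit Defensive.

Import Order.TTheory GRing.Theory Num.Theory.
Import numFieldNormedType.Exports.

Local Open Scope classical_set_scope.
Local Open Scope ring_scope.

(** * Bounded functionals *)

Section dual_facts.
Variables (R : realType) (X : normedModType R).
Implicit Types f g : dual_space X.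

Lemma dual_scalar f : scalar f.
Proof. by have /bounded_functionalP[] := valP f. Qed.

HB.instance Definition _ f :=
  GRing.isLinear.Build R X R *%R f (dual_scalar f).

Lemma dual_ext f g : (forall x, f x = g x) -> f = g.
Proof. by move=> fg; apply/val_inj/funext. Qed.

Lemma dual_fun_le f x : `|f x| <= `|f| * `|x|.
Proof. exact: dual_norm_ub. Qed.

Lemma dualD f g x : (f + g) x = f x + g x. Proof. by []. Qed.

Lemma dualB f g x : (f - g) x = f x - g x. Proof. by []. Qed.

Lemma dualZ a f x : (a *: f) x = a * f x. Proof. by []. Qed.

Lemma dual_sum (I : Type) (r : seq I) (F : I -> dual_space X) x :
  (\sum_(i <- r) F i) x = \sum_(i <- r) F i x.
Proof. by elim/big_rec2: _ => // i a b _ <-. Qed.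

Lemma dual_norm_bound f (M : R) :
  0 <= M -> (forall x, `|f x| <= M * `|x|) -> `|f| <= M.
Proof.
move=> M0 fM; apply: dual_norm_le => x x1; apply: le_trans (fM x) _.
by rewrite ler_piMr.
Qed.

Lemma dual_of_bounded (h : X -> R) (M : R) :
  scalar h -> 0 <= M -> (forall x, `|h x| <= M * `|x|) ->
  exists2 f : dual_space X, (forall x, f x = h x) & `|f| <= M.
Proof.
move=> hlin M0 hM.
have hb : h \in @bounded_functional R X.
  by apply/bounded_functionalP; split=> //; exists M.
by exists (DualSpace hb) => //; apply: dual_norm_bound.
Qed.

Lemma closed_dual_eval_eq (P : X -> X) :
  closed [set f : dual_space X | forall x, f (P x) = f x].
Proof.
move=> f clf x; apply/eqP; rewrite -subr_eq0 -normr_le0.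
apply/ler_addgt0Pr => e e0; rewrite add0r.
(* The summand 1 keeps M positive when x and P x vanish. *)
pose M := `|P x| + `|x| + 1.
have M0 : 0 < M by rewrite ltr_wpDl// addr_ge0.
have [g [/= gP fg]] := clf _ (nbhsx_ballx f (e / M) (divr_gt0 e0 M0)).
move: fg; rewrite -ball_normE/= => /ltW fg.
have -> : f (P x) - f x = (f - g) (P x) - (f - g) x.
  rewrite !dualB gP opprB addrA; congr (_ - _).
  by rewrite subrK.
apply: le_trans (ler_normB _ _) _.
apply: le_trans (lerD (dual_fun_le _ _) (dual_fun_le _ _)) _.
rewrite -mulrDr; apply: (@le_trans _ _ (e / M * M)); last first.
  by rewrite divfK ?gt_eqF.
by apply: ler_pM; rewrite ?addr_ge0// /M lerDl.
Qed.

End dual_facts.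

(** * Property (U) and property (SU) for the range of a contractive projection *)

Section contractive_projection.
Variables (R : realType) (X : normedModType R) (Y : submodClosed X).

Definition contractive_projection (P : X -> X) :=
  [/\ forall x, P x \in Y, forall y, y \in Y -> P y = y &
      forall x, `|P x| <= `|x|].

Lemma dual_restriction (g : dual_space X) :
  exists2 f : dual_space (lin_subspace Y),
    (forall y, g (\val y) = f y) & `|f| <= `|g|.
Proof.
have [|||f fE fM] := @dual_of_bounded R (lin_subspace Y) (g \o \val) `|g|.
- by move=> a u v; rewrite /= linearP.
- by [].
- by move=> y; apply: dual_fun_le.
by exists f => // y; rewrite fE.
Qed.

Lemma extension_norm_ge (g : dual_space X) (f : dual_space (lin_subspace Y)) :
  (forall y, g (\val y) = f y) -> `|f| <= `|g|.
Proof.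
have [f' f'E f'g] := dual_restriction g => gf.
by rewrite (_ : f = f') //; apply: dual_ext => y; rewrite -f'E.
Qed.

(** Precomposition with a contractive projection replaces the Hahn-Banach
theorem: it is a norm-preserving extension that depends linearly on the
functional. *)
Lemma dual_pullback (P : {linear X -> X}) (f : dual_space (lin_subspace Y)) :
  contractive_projection P ->
  exists2 F : dual_space X, (forall y, F (\val y) = f y) &
    `|F| <= `|f| /\ forall x, F (P x) = F x.
Proof.
move=> [PY Pid Ple].
have [|||F FE FM] :=
    @dual_of_bounded R X (fun x => f (LinSubspace (PY x))) `|f|.
- move=> a u v; rewrite -linearP; congr (dual_fun f _).
  by apply: val_inj; rewrite [RHS]linearP /= linearP.
- by [].
- move=> x; apply: le_trans (dual_fun_le _ _) _.
  by rewrite ler_wpM2l//; exact: Ple.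
exists F => [y|]; last split=> // x.
  by rewrite FE; congr (dual_fun f _); apply: val_inj; rewrite /= Pid ?(valP y).
by rewrite !FE; congr (dual_fun f _); apply: val_inj; rewrite /= Pid.
Qed.

(** The G-component of a norm-preserving extension is an extension too, hence
has no smaller norm, which by (SU) leaves no room for an annihilating part: all
norm-preserving extensions lie in G, where an element is determined by its
restriction to [Y].  The projection only provides existence. *)
Lemma contractive_projection_SU_U (P : {linear X -> X}) :
  contractive_projection P -> property_SU Y -> property_U Y.
Proof.
move=> cP [G [_ Gdec Glt]] f.
have inG (g : dual_space X) :
    (forall y, g (\val y) = f y) -> `|g| = `|f| -> g \in G.
  move=> gf gn; have [[g1 g2] [/= [g1G g2Y gE] _]] := Gdec g.
  have [g20|g2n0] := eqVneq g2 0; first by rewrite gE g20 addr0.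
  have := Glt g g1 g2 g1G g2Y g2n0 gE; rewrite gn ltNge extension_norm_ge//.
  by move=> y; rewrite -gf gE dualD g2Y ?addr0 ?(valP y).
have [F Ff [FM _]] := dual_pullback f cP.
have Fn : `|F| = `|f| by apply/eqP; rewrite eq_le FM extension_norm_ge.
exists F; split=> // g [gf gn].
have [p [_ pE]] := Gdec F.
have gFY : annihilator Y (F - g).
  move=> y yY; rewrite dualB.
  have := gf (LinSubspace yY); have := Ff (LinSubspace yY) => /= -> ->.
  by rewrite subrr.
have pF : p = (F, 0).
  by apply: pE; split; rewrite ?addr0 ?inG//= => y _.
have pg : p = (g, F - g) by apply: pE; split; rewrite /= ?inG// addrC subrK.
by have := pF; rewrite pg => -[].
Qed.

(** With G = {g | g o P = g}, the G-component of a functional is the pullback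
of its restriction to [Y]; it has minimal norm among all functionals with that
restriction, and by (U) it is the only one of that norm. *)
Lemma contractive_projection_U_SU (P : {linear X -> X}) :
  contractive_projection P -> property_U Y -> property_SU Y.
Proof.
move=> cP U; have [PY Pid Ple] := cP.
pose GP : {pred dual_space X} :=
  [pred f : dual_space X | `[< forall x, f (P x) = f x >]].
have GPmod : submod_closed GP.
  split; first by apply/asboolP.
  move=> a f g /asboolP fP /asboolP gP; apply/asboolP => x.
  by rewrite !dualD !dualZ fP gP.
pose G : submodClosed (dual_space X) :=
  HB.pack GP (GRing.isSubmodClosed.Build R (dual_space X) GP GPmod).
have GE g : g \in G <-> forall x, g (P x) = g x by split=> /asboolP.
have ext_eq (g h : dual_space X) : g \in G -> h \in G ->
    (forall y, y \in Y -> g y = h y) -> g = h.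
  by move=> /GE gP /GE hP gh; apply: dual_ext => x; rewrite -gP -hP gh.
have ext (g : dual_space X) : exists2 g' : dual_space X, g' \in G &
    (forall y, y \in Y -> g' y = g y) /\
    forall h : dual_space X, (forall y, y \in Y -> h y = g y) ->
      `|g'| <= `|h| /\ (`|g'| = `|h| -> h = g').
  have [f gf _] := dual_restriction g.
  have [F Ff [FM FP]] := dual_pullback f cP.
  exists F; first exact/GE.
  split=> [y yY|h hg].
    by rewrite -[y]/(\val (LinSubspace yY)) Ff gf.
  have hf y : h (\val y) = f y by rewrite hg ?(valP y)// gf.
  split=> [|Fh]; first exact: le_trans FM (extension_norm_ge hf).
  have [g0 [_ g0E]] := U f.
  have Fn : `|F| = `|f| by apply/eqP; rewrite eq_le FM extension_norm_ge.
  by rewrite -(g0E h) -?Fh// -(g0E F).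
exists G; split.
- rewrite (_ : [set` G] = [set f : dual_space X | forall x, f (P x) = f x]).
    exact: closed_dual_eval_eq.
  by apply/seteqP; split=> f /= /GE.
- move=> f; have [g gG [gf _]] := ext f.
  exists (g, f - g); split.
    split=> //=; last by rewrite addrC subrK.
    by move=> y yY; rewrite dualB gf ?subrr.
  move=> [g' h] [/= g'G hY fE].
  have -> : g = g'.
    apply: ext_eq => // y yY.
    by rewrite gf// fE dualD hY ?addr0.
  by rewrite fE addrAC subrr add0r.
move=> f g h gG hY hn0 fE.
have [g' g'G [g'f g'le]] := ext f.
have gg' : g = g'.
  apply: ext_eq => // y yY.
  by rewrite g'f// fE dualD hY ?addr0.
have [le eq] := g'le f (fun _ _ => erefl).
rewrite lt_neqAle gg' le andbT; apply/eqP => /eq.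
rewrite -gg' fE => /eqP; rewrite -subr_eq0 addrAC subrr add0r.
exact/negP.
Qed.

End contractive_projection.

(** * The norm of [ell1] and the pairing with bounded sequences *)

Section ell1_facts.
Variable R : realType.
Implicit Types (u v x y : ell1 R) (s : nat -> R).

Lemma ell1_ext u v : (forall k, u k = v k) -> u = v.
Proof. by move=> uv; apply/val_inj/funext. Qed.

Lemma ell1_seq_sum (I : Type) (r : seq I) (F : I -> ell1 R) k :
  (\sum_(i <- r) F i) k = \sum_(i <- r) F i k.
Proof. by elim/big_rec2: _ => // i a b _ <-. Qed.

Lemma ell1_summable u : cvgn (series (fun k => `|u k|)).
Proof. exact/absolutely_summableP/(valP u). Qed.
Arguments ell1_summable : clear implicits.

(** The coordinatewise defects of the triangle inequality are nonnegative and
their sum is the defect of the norms, so one vanishes when the other does. *)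
Lemma ell1_normDP u v :
  (`|u + v| = `|u| + `|v|) <-> (forall k, `|u k + v k| = `|u k| + `|v k|).
Proof.
have cu := (ell1_summable u); have cv := (ell1_summable v).
have cuv := ell1_summable (u + v).
have sumE : `|u| + `|v| = limn (series (fun k => `|u k| + `|v k|)).
  by rewrite !ell1_normE -lim_seriesD.
have csum : cvgn (series (fun k => `|u k| + `|v k|)) by exact: is_cvg_seriesD.
split=> [uv k|uv]; last first.
  by rewrite sumE ell1_normE; under eq_fun do rewrite ell1_seqD uv.
pose d k := `|u k| + `|v k| - `|(u + v) k|.
have d0 j : 0 <= d j by rewrite subr_ge0 ler_normD.
have cd : cvgn (series d) by exact: is_cvg_seriesB.
have d_lim : limn (series d) = 0.
  by rewrite /d [LHS](lim_seriesB csum cuv) -sumE -ell1_normE uv subrr.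
have d_nd : nondecreasing_seq (series d).
  exact: nondecreasing_series (fun j _ _ => d0 j).
have := nondecreasing_cvgn_le d_nd cd k.+1.
rewrite d_lim /series/= big_nat_recr//= => dk.
have {dk} : d k <= 0 by apply: le_trans dk; rewrite lerDr sumr_ge0.
rewrite subr_le0 => dk; apply/eqP; rewrite eq_le ler_normD; exact: dk.
Qed.

Lemma ell1_norm_sum_disjoint (I : eqType) (r : seq I) (e : I -> ell1 R) :
  uniq r -> (forall i j k, i != j -> e i k != 0 -> e j k = 0) ->
  `|\sum_(i <- r) e i| = \sum_(i <- r) `|e i|.
Proof.
move=> + de; elim: r => [|i r IHr] /=; first by rewrite !big_nil normr0.
move=> /andP[ir ur]; rewrite !big_cons -IHr//.
apply/ell1_normDP => k; rewrite ell1_seq_sum.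
have [->|eik] := eqVneq (e i k) 0; first by rewrite normr0 !add0r.
rewrite big_seq big1 ?addr0 ?normr0 ?addr0// => j jr.
by apply: (de i) => //; apply: contraNneq ir => ->.
Qed.

(** The duality bracket between bounded and summable sequences. *)
Definition pairing s x : R := limn (series (fun k => s k * x k)).

Lemma pairing_normed_cvg s x (M : R) : (forall k, `|s k| <= M) ->
  cvgn [normed series (fun k => s k * x k)].
Proof.
move=> sM; have M0 : 0 <= M := le_trans (normr_ge0 _) (sM 0%N).
apply: (@series_le_cvg _ _ (M *: (fun k => `|x k|))) => [k|k|k|].
- exact: normr_ge0.
- exact: mulr_ge0.
- by rewrite /= normrM; apply: ler_wpM2r.
- exact/is_cvg_seriesZ/ell1_summable.
Qed.

Lemma pairing_cvg s x (M : R) : (forall k, `|s k| <= M) ->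
  cvgn (series (fun k => s k * x k)).
Proof. by move=> sM; apply: normed_cvg; exact: pairing_normed_cvg sM. Qed.

Lemma pairing_linear s (M : R) : (forall k, `|s k| <= M) -> scalar (pairing s).
Proof.
move=> sM a u v.
have cu := @pairing_cvg s u M sM; have cv := @pairing_cvg s v M sM.
rewrite /pairing -[a * _]lim_seriesZ// -lim_seriesD//; last first.
  exact: is_cvg_seriesZ.
by under eq_fun do rewrite ell1_seqD ell1_seqZ mulrDr mulrCA.
Qed.

Lemma pairing_le s x (M : R) :
  (forall k, `|s k| <= M) -> `|pairing s x| <= M * `|x|.
Proof.
move=> sM; have cn := @pairing_normed_cvg s x M sM.
apply: le_trans (lim_series_norm cn) _.
rewrite ell1_normE -[M * _]lim_seriesZ//; last exact: ell1_summable.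
apply: lim_series_le => //; first exact/is_cvg_seriesZ/ell1_summable.
by move=> k; rewrite /= normrM; apply: ler_wpM2r.
Qed.

Lemma pairing_suml n (a : 'I_n -> R) (s : 'I_n -> nat -> R) x (M : R) :
  (forall i k, `|s i k| <= M) ->
  \sum_(i < n) a i * pairing (s i) x =
  pairing (fun k => \sum_(i < n) a i * s i k) x.
Proof.
move=> sM; apply/esym/cvg_lim => //.
rewrite (_ : series _ =
  (fun m => \sum_(i < n) a i * series (fun k => s i k * x k) m)).
  apply: (@cvg_big _ _ +%R 0 xpredT) => [|i _]; first exact: add_continuous.
  by apply: cvgMl_tmp; exact: pairing_cvg (sM i).
apply/funext => m; rewrite /series/=.
under [RHS]eq_bigr do rewrite /series/= big_distrr/=.
rewrite exchange_big/=; apply: eq_bigr => k _; rewrite big_distrl/=.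
by apply: eq_bigr => i _; rewrite mulrA.
Qed.

Lemma sg_bound u k : `|Num.sg (u k)| <= 1.
Proof. by rewrite normr_sg; case: eqP => _ /=; rewrite ?ler01. Qed.

Lemma pairing_sg u : pairing (fun k => Num.sg (u k)) u = `|u|.
Proof.
by rewrite ell1_normE /pairing; under eq_fun do rewrite -normrEsg.
Qed.

(** By [pairing_sg], the value of this functional at [u] is |u|. *)
Lemma sign_functional u : exists2 f : dual_space (ell1 R),
  (forall x, f x = pairing (fun k => Num.sg (u k)) x) & `|f| <= 1.
Proof.
apply: dual_of_bounded; first exact: pairing_linear (sg_bound u).
  exact: ler01.
by move=> x; apply: pairing_le => k; exact: sg_bound.
Qed.

Lemma pairing_eq0 s x : (forall k, s k * x k = 0) -> pairing s x = 0.
Proof.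
move=> sx; rewrite /pairing (_ : series _ = cst 0) ?lim_cst//.
by apply/funext => n; rewrite /series/= big1.
Qed.

Lemma delta_summable (k : nat) :
  (fun j => (j == k)%:R : R) \in @absolutely_summable R.
Proof.
have [] // := @sum_norm_ub R (fun j => (j == k)%:R) 1.
move=> n; rewrite (eq_bigr (fun j => (j == k)%:R)); last first.
  by move=> j _; rewrite normr_nat.
elim: n => [|n IHn]; first by rewrite big_geq.
rewrite big_nat_recr//=; have [nk|] := eqVneq n k; last by rewrite addr0.
by rewrite big_nat big1 ?add0r// => j /andP[_ jn]; rewrite -nk ltn_eqF.
Qed.

Definition ell1_delta k : ell1 R := Ell1 (delta_summable k).

End ell1_facts.

(** * A basis dual to finitely many coordinates *)

Section finite_dimensional_subspace.
Variables (R : realType) (Y : submodClosed (ell1 R)).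

Definition coordinate_system n (k : 'I_n -> nat) (y : 'I_n -> ell1 R) :=
  [/\ forall i, y i \in Y, forall i j, y i (k j) = (i == j)%:R &
      forall v, v \in Y -> v = \sum_(i < n) v (k i) *: y i].

(** As long as [m < n], some nonzero combination of the [c i] vanishes at the
chosen coordinates; a coordinate where it does not vanish can be added. *)
Lemma independent_coordinates n (c : 'I_n -> ell1 R) :
  (forall a : 'rV[R]_n, \sum_i a ord0 i *: c i = 0 -> a = 0) ->
  forall m, (m <= n)%N ->
  exists k : 'I_m -> nat, row_free (\matrix_(j < m, i < n) c i (k j)).
Proof.
move=> cfree; elim=> [_|m IHm mn].
  by exists (fun=> 0%N); rewrite -row_leq_rank.
have [k kfree] := IHm (ltnW mn).
set A := \matrix_(j, i) _ in kfree.
have : kermx A^T != 0.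
  rewrite kermx_eq0 -row_leq_rank mxrank_tr -ltnNge.
  exact: leq_ltn_trans (rank_leq_row A) mn.
move=> /rowV0Pn[a /sub_kermxP aA a0].
have [q aq] : exists q, (\sum_i a ord0 i *: c i) q != 0.
  apply: contrapT => /forallNP aq; case/eqP: a0; apply: cfree.
  by apply: ell1_ext => q; apply/eqP; rewrite -[_ == _]negbK; exact/negP/(aq q).
pose k' j := oapp k q (unlift ord0 j).
exists k'; apply: inj_row_free => w wA.
have w0 : w ord0 ord0 = 0.
  have : (w *m (\matrix_(j < m.+1, i < n) c i (k' j)) *m a^T) ord0 ord0 = 0.
    by rewrite wA mul0mx mxE.
  rewrite -mulmxA mxE big_ord_recl big1 => [|j _]; last first.
    have -> : (\matrix_(j < m.+1, i < n) c i (k' j) *m a^T) (lift ord0 j) ord0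
        = (a *m A^T) ord0 j.
      rewrite mxE [RHS]mxE; apply: eq_bigr => i _.
      by rewrite !mxE /k' liftK mulrC.
    by rewrite aA mxE mulr0.
  rewrite addr0 => /eqP; rewrite mulf_eq0 => /orP[/eqP//|].
  rewrite mxE (_ : \sum_j _ = (\sum_i a ord0 i *: c i) q) ?(negPf aq)//.
  rewrite ell1_seq_sum; apply: eq_bigr => i _.
  by rewrite !mxE /k' unlift_none mulrC.
have wl0 : \row_j w ord0 (lift ord0 j) = 0.
  apply: (row_free_inj kfree); rewrite mul0mx -wA; apply/rowP => i.
  rewrite !mxE big_ord_recl w0 mul0r add0r.
  by apply: eq_bigr => j _; rewrite !mxE /k' liftK.
apply/rowP => j; rewrite mxE; case: (unliftP ord0 j) => [j' ->|-> //].
by have /rowP/(_ j') := wl0; rewrite !mxE.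
Qed.

(** The matrix of [n] independent coordinates of a basis is square and
invertible; changing the basis by its inverse gives the dual basis. *)
Lemma coordinate_system_exists n : has_dimension (lin_subspace Y) n ->
  exists k y, @coordinate_system n k y.
Proof.
move=> [b bP]; pose c i : ell1 R := \val (b i).
have val_sum (a : 'rV[R]_n) :
    \val (\sum_i a ord0 i *: b i) = \sum_i a ord0 i *: c i.
  by rewrite raddf_sum.
have cfree (a : 'rV[R]_n) : \sum_i a ord0 i *: c i = 0 -> a = 0.
  rewrite -val_sum => ca; have [a' [_ a'P]] := bP 0.
  rewrite -(a'P a); last by apply: val_inj; rewrite ca.
  by apply: a'P; rewrite big1// => i _; rewrite mxE scale0r.
have [k kfree] := independent_coordinates cfree (leqnn n).
set A := \matrix_(j, i) _ in kfree.
have Au : A \in unitmx by rewrite -row_free_unit.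
exists k, (fun i => \sum_l invmx A l i *: c l); split=> [i|i j|v vY].
- by apply: rpred_sum => l _; apply: rpredZ; exact: valP (b l).
- have /matrixP/(_ j i) := mulmxV Au; rewrite !mxE eq_sym => <-.
  by rewrite ell1_seq_sum; apply: eq_bigr => l _; rewrite !mxE mulrC.
have [a [vE _]] := bP (LinSubspace vY).
have {}vE : v = \sum_l a ord0 l *: c l by rewrite -val_sum -vE.
have vk i : v (k i) = (A *m a^T) i ord0.
  by rewrite vE ell1_seq_sum mxE; apply: eq_bigr => l _; rewrite !mxE mulrC.
under [RHS]eq_bigr => i _ do rewrite vk scaler_sumr.
rewrite exchange_big/= [LHS]vE; apply: eq_bigr => l _.
under eq_bigr do rewrite scalerA mulrC.
rewrite -scaler_suml; congr (_ *: _).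
have /matrixP/(_ l ord0) := mulKmx Au a^T; rewrite mxE => ->.
by rewrite mxE.
Qed.

(** * From property (SU) to a contractive projection *)

(** The functionals [g i] are the components in G of the coordinates [k i].
For the norm bound, take a norm-one functional [f] with f (P x) = |P x|; its
component [h] in G agrees with it on [Y] and is a combination of the [g i],
which gives h (P x) = h x, so that |P x| = h x <= |x|. *)
Lemma property_SU_contractive_projection n :
  has_dimension (lin_subspace Y) n -> property_SU Y ->
  exists P : {linear ell1 R -> ell1 R}, contractive_projection Y P.
Proof.
move=> /coordinate_system_exists[k [y [yY yk yE]]] [G [_ Gdec Glt]].
have split_dual (f : dual_space (ell1 R)) : exists2 g : dual_space (ell1 R),
    g \in G & (forall v, v \in Y -> g v = f v) /\ `|g| <= `|f|.
  have [[g h] [/= [gG hY fE] _]] := Gdec f; exists g => //; split.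
    by move=> v vY; rewrite fE dualD hY ?addr0.
  have [h0|h0] := eqVneq h 0; first by rewrite fE h0 addr0.
  exact/ltW/(Glt f g h).
have G_ext (g h : dual_space (ell1 R)) : g \in G -> h \in G ->
    (forall v, v \in Y -> g v = h v) -> g = h.
  move=> gG hG gh; have [p [_ pE]] := Gdec g.
  have pg : p = (g, 0) by apply: pE; split; rewrite ?addr0// => v _.
  have : p = (h, g - h).
    apply: pE; split=> //=; last by rewrite addrC subrK.
    by move=> v vY; rewrite dualB gh ?subrr.
  by rewrite pg => -[].
have /choice[g gP] : forall i, exists g : dual_space (ell1 R),
    g \in G /\ forall v, v \in Y -> g v = v (k i).
  move=> i.
  have [|||f fE _] := @dual_of_bounded R (ell1 R) (fun x => x (k i)) 1.
  - by move=> a u v; rewrite ell1_seqD ell1_seqZ.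
  - exact: ler01.
  - by move=> x; rewrite mul1r ell1_norm_coord.
  have [g gG [gf _]] := split_dual f; exists g; split=> // v vY.
  by rewrite gf// fE.
pose Pf x := \sum_i g i x *: y i.
have Plin : linear Pf.
  move=> a u v; rewrite /Pf scaler_sumr -big_split/=; apply: eq_bigr => i _.
  by rewrite linearP scalerDl scalerA.
pose P : {linear ell1 R -> ell1 R} :=
  HB.pack Pf (GRing.isLinear.Build R (ell1 R) (ell1 R) *:%R Pf Plin).
exists P.
have PY x : Pf x \in Y by apply: rpred_sum => i _; apply: rpredZ.
split=> //= [v vY|x].
  by rewrite [RHS]yE//; apply: eq_bigr => i _; rewrite (gP i).2.
have [f fE f1] := sign_functional (Pf x).
have [h hG [hf hle]] := split_dual f.
have hE : h = \sum_i f (y i) *: g i.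
  apply: G_ext => // [|v vY].
    by apply: rpred_sum => i _; apply: rpredZ; exact: (gP i).1.
  rewrite dual_sum [in LHS](yE v)// linear_sum/=; apply: eq_bigr => i _.
  transitivity (f (y i) * g i v); last by [].
  by rewrite (gP i).2// -hf// linearZ/= mulrC.
have -> : `|Pf x| = h x.
  rewrite -(pairing_sg (Pf x)) -fE hE dual_sum linear_sum/=.
  by apply: eq_bigr => i _; rewrite linearZ/= mulrC.
apply: le_trans (ler_norm _) _; apply: le_trans (dual_fun_le _ _) _.
by rewrite ler_piMl// (le_trans hle).
Qed.

(** * From a contractive projection to an isometry with [ell1n] *)

(** Each [y i] has minimal support in [Y], since a vector of [Y] supported in
the support of [y i] vanishes at [k l] for l <> i.  For [q] in the support of
[y i], the image under P of the unit vector at [q] is nonzero and supported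
there, so it is a multiple of [y i] and its coordinates at the [k l] single
out [i]. *)
Lemma contractive_projection_disjoint (P : {linear ell1 R -> ell1 R})
    n (k : 'I_n -> nat) (y : 'I_n -> ell1 R) :
  contractive_projection Y P -> coordinate_system k y ->
  forall i j q, i != j -> y i q != 0 -> y j q = 0.
Proof.
move=> [PY Pid Ple] [yY yk yE].
have key i q l : y i q != 0 -> (P (ell1_delta R q) (k l) == 0) = (l != i).
  move=> yiq; pose s := y i q *: ell1_delta R q.
  have sE j : s j = y i q * (j == q)%:R by [].
  have yE' : s + (y i - s) = y i by rewrite addrC subrK.
  have snorm : `|y i| = `|s| + `|y i - s|.
    rewrite -[in LHS]yE'; apply/ell1_normDP => j; rewrite ell1_seqB sE.
    have [->|_] := eqVneq j q; first by rewrite mulr1 subrr normr0 !addr0.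
    by rewrite mulr0 subr0 normr0 !add0r.
  have uv : P s + P (y i - s) = y i by rewrite -linearD yE' Pid.
  have uvnorm : `|P s + P (y i - s)| = `|P s| + `|P (y i - s)|.
    by apply/eqP; rewrite eq_le ler_normD uv snorm lerD.
  (* Equality in the triangle inequality forbids cancellation: P s lives on
     the support of y i. *)
  have Ps0 j : y i j = 0 -> P s j = 0.
    move=> yij; apply/eqP; rewrite -normr_le0.
    have /ell1_normDP/(_ j) := uvnorm.
    by rewrite -ell1_seqD uv yij normr0 => ->; rewrite lerDl.
  have Pdelta j : P s j = y i q * P (ell1_delta R q) j by rewrite linearZ.
  have Pdelta0 j : (P (ell1_delta R q) j == 0) = (P s j == 0).
    by rewrite Pdelta mulf_eq0 (negPf yiq).
  rewrite Pdelta0; have [->/=|li] := eqVneq l i; last first.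
    by rewrite Ps0 ?eqxx// yk eq_sym (negPf li).
  apply/eqP => Psi; have Ps : P s = 0.
    rewrite (yE (P s))// big1// => j _.
    have [->|ji] := eqVneq j i; first by rewrite Psi scale0r.
    by rewrite Ps0 ?scale0r// yk eq_sym (negPf ji).
  (* If P s were 0, then y i would be the image of y i - s alone, whose norm is
     smaller by that of s. *)
  have : `|s| <= 0.
    rewrite -(lerD2r `|y i - s|) -snorm add0r -[in X in X <= _]uv Ps add0r.
    exact: Ple.
  rewrite normr_le0 => /eqP s0; case/eqP: yiq.
  by have := sE q; rewrite s0 eqxx mulr1.
move=> i j q ij yiq; apply/eqP; apply: contraTT ij => yjq.
by rewrite negbK -[_ == _]negbK -(key j q i yjq) (key i q i yiq) eqxx.
Qed.

Lemma ell1n_coordP n (a : R) (x y : ell1n R n) i :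
  ((a *: x + y : ell1n R n) : 'rV[R]_n) ord0 i =
  a * (x : 'rV[R]_n) ord0 i + (y : 'rV[R]_n) ord0 i.
Proof.
(* Only the norm distinguishes ell1n from row vectors. *)
have -> : a *: x + y = (a *: (x : 'rV[R]_n) + (y : 'rV[R]_n)) by [].
by rewrite !mxE.
Qed.

Lemma contractive_projection_isometry (P : {linear ell1 R -> ell1 R}) n :
  contractive_projection Y P -> has_dimension (lin_subspace Y) n ->
  isometrically_isomorphic (lin_subspace Y) (ell1n R n).
Proof.
move=> cP /coordinate_system_exists[k [y ky]].
have ydisj := contractive_projection_disjoint cP ky.
have [yY yk yE] := ky.
have yn0 i : `|y i| != 0.
  rewrite normr_eq0; apply/eqP => yi; have := yk i i.
  by rewrite yi eqxx => /eqP; rewrite eq_sym oner_eq0.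
pose Tf (v : lin_subspace Y) : ell1n R n :=
  \row_i ((\val v : ell1 R) (k i) * `|y i|).
have Tlin : linear Tf.
  move=> a u v; apply/rowP => i; rewrite ell1n_coordP ![Tf _ _ _]mxE.
  rewrite (_ : (\val (a *: u + v) : ell1 R) (k i) =
    a * (\val u : ell1 R) (k i) + (\val v : ell1 R) (k i)).
    by rewrite mulrDl mulrA.
  by rewrite linearP.
pose T : {linear lin_subspace Y -> ell1n R n} := HB.pack Tf
  (GRing.isLinear.Build R (lin_subspace Y) (ell1n R n) *:%R Tf Tlin).
exists T.
have val_comb (a : 'I_n -> R) :
    \val (\sum_i a i *: LinSubspace (yY i)) = \sum_i a i *: y i.
  by rewrite raddf_sum.
split=> /= [|v].
  exists (fun a : ell1n R n =>
    \sum_i ((a : 'rV[R]_n) ord0 i / `|y i|) *: LinSubspace (yY i)).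
    move=> v; apply: val_inj; rewrite val_comb [RHS]yE ?(valP v)//.
    by apply: eq_bigr => i _; rewrite mxE mulfK.
  move=> a; apply/rowP => i; rewrite mxE val_comb ell1_seq_sum (bigD1 i)//.
  rewrite big1 => [|j /andP[_ ji]]; rewrite ell1_seqZ yk.
    by rewrite eqxx mulr1 [X in X * _]addr0 divfK.
  by rewrite (negPf ji) mulr0.
rewrite -[RHS]/(`|\val v|) (yE (\val v)) ?(valP v)// ell1_norm_sum_disjoint//.
- by apply: eq_bigr => i _; rewrite mxE normrM normrZ normr_id.
- exact: index_enum_uniq.
move=> i j q ij; rewrite !ell1_seqZ mulf_eq0 negb_or => /andP[_ yiq].
by rewrite (ydisj i j q) ?mulr0.
Qed.

End finite_dimensional_subspace.

(** * From an isometry with [ell1n] to a contractive projection *)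

Section isometry_to_projection.
Variables (R : realType) (Y : submodClosed (ell1 R)) (n : nat).

Lemma isometry_ell1n_basis :
  isometrically_isomorphic (lin_subspace Y) (ell1n R n) ->
  exists e : 'I_n -> ell1 R, [/\ forall i, e i \in Y,
    forall v, v \in Y -> exists a : 'I_n -> R, v = \sum_i a i *: e i &
    forall a : 'I_n -> R, `|\sum_i a i *: e i| = \sum_i `|a i|].
Proof.
move=> [T [[S ST TS] Tn]].
pose d (i : 'I_n) : ell1n R n := delta_mx ord0 i.
have val_comb (a : 'I_n -> R) :
    \val (\sum_i a i *: S (d i)) = \sum_i a i *: \val (S (d i)).
  by rewrite raddf_sum.
have T_comb (a : 'I_n -> R) : T (\sum_i a i *: S (d i)) = \row_i a i.
  rewrite linear_sum/= [RHS]row_sum_delta; apply: eq_bigr => i _.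
  by rewrite linearZ/= TS mxE.
exists (fun i => \val (S (d i))); split=> [i|v vY|a].
- exact: valP.
- exists (fun i => (T (LinSubspace vY) : 'rV[R]_n) ord0 i).
  rewrite -val_comb; apply: (congr1 val (x := LinSubspace vY)).
  apply: (can_inj ST); rewrite T_comb; apply/rowP => i.
  by rewrite mxE.
rewrite -val_comb -[LHS]/(`|\sum_i a i *: S (d i)|) -Tn T_comb.
by apply: eq_bigr => i _; rewrite mxE.
Qed.

(** The norms of e_i + e_j and e_i - e_j are both the sum of the norms of e_i
and e_j, so coordinatewise |u + v| = |u| + |v| = |u - v|, which forces
u v = 0. *)
Lemma ell1n_basis_disjoint (e : 'I_n -> ell1 R) :
  (forall a : 'I_n -> R, `|\sum_i a i *: e i| = \sum_i `|a i|) ->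
  forall i j q, i != j -> e i q != 0 -> e j q = 0.
Proof.
move=> en i j q ij eiq.
pose f s t (l : 'I_n) : R := if l == i then s else if l == j then t else 0.
have two (V : zmodType) (F : 'I_n -> V) :
    (forall l, l != i -> l != j -> F l = 0) -> \sum_l F l = F i + F j.
  move=> F0; rewrite (bigD1 i)//= (bigD1 j) 1?eq_sym//= big1 ?addr0//.
  by move=> l /andP[li lj]; exact: F0.
have f0 s t l : l != i -> l != j -> f s t l = 0.
  by rewrite /f => /negPf-> /negPf->.
have fi s t : f s t i = s by rewrite /f eqxx.
have fj s t : f s t j = t by rewrite /f eq_sym (negPf ij) eqxx.
have comb s t : `|s *: e i + t *: e j| = `|s| + `|t|.
  have := en (f s t); rewrite !two ?fi ?fj// => l li lj.
    by rewrite f0// normr0.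
  by rewrite f0// scale0r.
have pt t : `|e i q + t * e j q| = `|e i q| + `|t| * `|e j q|.
  have : `|1 *: e i + t *: e j| = `|1 *: e i| + `|t *: e j|.
    have := comb 1 0; rewrite scale0r addr0 normr0 addr0 => ->.
    by have := comb 0 t; rewrite scale0r add0r normr0 add0r => ->; exact: comb.
  by move/ell1_normDP/(_ q); rewrite scale1r ell1_seqZ normrM.
have := pt 1; have := pt (-1).
rewrite normrN normr1 !mul1r mulN1r => <- /(congr1 (fun z => z ^+ 2)).
rewrite !real_normK ?num_real// => sq; apply/eqP.
have : e i q * e j q = 0 by lra.
by move/eqP; rewrite mulf_eq0 (negPf eiq).
Qed.

(** For the norm bound, |P x| = sum_i |F_i x| is the pairing of [x] with a
combination of the sign sequences of the [e i] with coefficients of absolute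
value at most one; by disjointness of the supports, that combination is bounded
by one. *)
Lemma isometry_contractive_projection :
  isometrically_isomorphic (lin_subspace Y) (ell1n R n) ->
  exists P : {linear ell1 R -> ell1 R}, contractive_projection Y P.
Proof.
move=> /isometry_ell1n_basis[e [eY espan en]].
have edisj := ell1n_basis_disjoint en.
have /choice[F FE] : forall i, exists F : dual_space (ell1 R),
    forall x, F x = pairing (fun q => Num.sg (e i q)) x.
  by move=> i; have [F FE _] := sign_functional (e i); exists F.
have e1 i : `|e i| = 1.
  have := en (fun j => (j == i)%:R).
  rewrite (bigD1 i)//= big1 => [|j /negPf->]; last by rewrite scale0r.
  rewrite eqxx scale1r addr0 => ->.
  rewrite (bigD1 i)//= big1 => [|j /negPf->]; last exact: normr0.
  by rewrite eqxx normr1 addr0.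
have Fe i j : F i (e j) = (i == j)%:R.
  rewrite FE; have [<-|ij] := eqVneq i j; first by rewrite pairing_sg.
  apply: pairing_eq0 => q; have [->|eiq] := eqVneq (e i q) 0.
    by rewrite sgr0 mul0r.
  by rewrite (edisj i j)// mulr0.
pose Pf x := \sum_i F i x *: e i.
have Plin : linear Pf.
  move=> a u v; rewrite /Pf scaler_sumr -big_split/=; apply: eq_bigr => i _.
  by rewrite linearP scalerDl scalerA.
pose P : {linear ell1 R -> ell1 R} :=
  HB.pack Pf (GRing.isLinear.Build R (ell1 R) (ell1 R) *:%R Pf Plin).
exists P; split=> /= [x|v /espan[a ->]|x].
- by apply: rpred_sum => i _; apply: rpredZ.
- apply: eq_bigr => i _; congr (_ *: _).
  rewrite linear_sum (bigD1 i)//= big1 ?addr0 => [|j ji].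
    by rewrite linearZ/= Fe eqxx mulr1.
  by rewrite linearZ/= Fe eq_sym (negPf ji) mulr0.
rewrite en; under eq_bigr do rewrite normrEsg FE.
rewrite (@pairing_suml R n _ _ x 1) => [|i q]; last exact: sg_bound.
apply: le_trans (ler_norm _) _; rewrite -[leRHS]mul1r; apply: pairing_le => q.
have [[i eiq]|none] := pselect (exists i, e i q != 0).
  rewrite (bigD1 i)//= big1 ?addr0 => [|j ji].
    by rewrite normrM mulr_ile1 ?sg_bound// normr_sg lern1 leq_b1.
  have -> : e j q = 0 by apply: (edisj i) => //; rewrite eq_sym.
  by rewrite sgr0 mulr0.
rewrite big1 ?normr0 ?ler01// => i _.
have [->|eiq] := eqVneq (e i q) 0; first by rewrite sgr0 mulr0.
by case: none; exists i.
Qed.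

End isometry_to_projection.

Theorem theorem3p4 (R : realType) (Y : submodClosed (ell1 R))
    (finY : finite_dimensional (lin_subspace Y)) :
  property_SU Y <->
  property_U Y /\
  isometrically_isomorphic (lin_subspace Y)
    (ell1n R (dimension (lin_subspace Y))).
Proof.
have [n Yn] := finY; rewrite (dimensionE Yn); split=> [SU|[U]].
  have [P cP] := property_SU_contractive_projection Yn SU.
  split; first exact: contractive_projection_SU_U cP SU.
  exact: contractive_projection_isometry cP Yn.
move=> /isometry_contractive_projection[P cP].
exact: contractive_projection_U_SU cP U.
Qed.
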